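(* For every $n\ge 1$ there exists an involution $\Phi$ on $S_n$ such that for all $\pi\in S_n$ the following three equalities hold simultaneously: $$(21,\{(0,1),(1,0),(2,0)\})(\pi)=(21,\{(0,2),(1,0),(2,0)\})(\Phi(\pi)),$$ $$(21,\{(0,1),(0,2),(1,0),(1,2),(2,0)\})(\pi)=(21,\{(0,1),(0,2),(1,0),(1,1),(2,0)\})(\Phi(\pi)),$$ $$(21,\{(0,1),(1,0),(1,2),(2,0)\})(\pi)=(21,\{(0,2),(1,0),(1,1),(2,0)\})(\Phi(\pi)).$$
   Context: $S_n$ is the set of permutations of $\{1,\dots,n\}$ in one-line notation. A mesh pattern of length $k$ is a pair $(\tau,R)$ with $\tau\in S_k$ and $R\subseteq\{0,\dots,k\}\times\{0,\dots,k\}$ (the set of shaded boxes; $(i,j)$ is the box in column $i$, row $j$, with lower left corner $(i,j)$). An occurrence of $(\tau,R)$ in $\pi\in S_n$ is a choice of positions $a_1<\cdots<a_k$ such that $\pi(a_1)\cdots\pi(a_k)$ is order-isomorphic to $\tau$ and, writing $v_1<\cdots<v_k$ for the values $\pi(a_1),\dots,\pi(a_k)$ sorted increasingly and $a_0=v_0=0$, $a_{k+1}=v_{k+1}=n+1$, for every $(i,j)\in R$ there is no position $c$ with $a_i<c<a_{i+1}$ and $v_j<\pi(c)<v_{j+1}$. For a mesh pattern $p$, $p(\pi)$ denotes the number of occurrences of $p$ in $\pi$. An involution is a map equal to its own inverse. *)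

(* Defs.v *)
From mathcomp Require Import all_boot all_fingroup.

Set Implicit Arguments.
Unset Strict Implicit.
Unset Printing Implicit Defensive.

(* The permutations of {1, ..., n} are 'S_n, whose elements act on the ordinals
   0, ..., n - 1.  Occurrences below are written with 1-based positions and
   values, so the ordinal x stands for the number x.+1. *)

(* The box (i, j) in column i and row j is shaded when it belongs to the set. *)
Record mesh_pattern (k : nat) : Type := MeshPattern {
  mesh_perm : 'S_k;
  mesh_shading : {set 'I_k.+1 * 'I_k.+1}
}.

Section Occurrences.

Variables (k n : nat) (p : mesh_pattern k) (pi : 'S_n).

Implicit Type a : {ffun 'I_k -> 'I_n}.

Definition increasing_positions a : bool :=
  [forall i : 'I_k, forall j : 'I_k, (i < j) ==> (a i < a j)].

Definition order_isomorphic a : bool :=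
  [forall i : 'I_k, forall j : 'I_k, (pi (a i) < pi (a j)) == (mesh_perm p i < mesh_perm p j)].

(* a_i for 0 <= i <= k + 1, with a_0 = 0 and a_(k+1) = n + 1. *)
Definition column_bound a (i : nat) : nat :=
  nth 0 (0 :: rcons [seq (a x).+1 | x <- enum 'I_k] n.+1) i.

(* v_j for 0 <= j <= k + 1, with v_0 = 0 and v_(k+1) = n + 1. *)
Definition row_bound a (j : nat) : nat :=
  nth 0 (0 :: rcons (sort leq [seq (pi (a x)).+1 | x <- enum 'I_k]) n.+1) j.

Definition in_box a (b : 'I_k.+1 * 'I_k.+1) (c : 'I_n) : bool :=
  (column_bound a b.1 < c.+1 < column_bound a b.1.+1) &&
  (row_bound a b.2 < (pi c).+1 < row_bound a b.2.+1).

Definition occurrence a : bool :=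
  [&& increasing_positions a, order_isomorphic a &
      [forall b in mesh_shading p, ~~ [exists c, in_box a b c]]].

Definition mesh_count : nat := #|[set a | occurrence a]|.

End Occurrences.

(* The pattern (21, R), with R given by the list of its boxes. *)
Definition mesh21 (boxes : seq (nat * nat)) : mesh_pattern 2 :=
  MeshPattern (tperm ord0 ord_max)
    [set b : 'I_3 * 'I_3 | (val b.1, val b.2) \in boxes].

(* Main.v *)
(* Index from 0. Let L_i be the number of c < i with pi c < pi i (the Lehmer
   code), q be the position of the minimum of pi on [i, n), which is also the
   last position where L is minimal on [i, n). Phi keeps L_i when q = i and
   otherwise reflects it in the interval [L_q, i]. This preserves the map i
   |-> q, so it is an involution on codes. In all six patterns row 0 is
   shaded in columns 1 and 2, which forces an occurrence to consist of
   positions i < j = q. For such a pair, the box (0, 1) is empty iff L_i =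
   L_j, and then (1, 2) is empty iff L_t < L_j + t - i for all i < t < j; the
   box (0, 2) is empty iff L_i = i, and then (1, 1) is empty iff L_t > i for
   all i < t < j. The reflection exchanges these conditions, so pi and Phi pi
   have corresponding occurrences at the same positions. *)

Require Import Defs.
From mathcomp Require Import all_boot all_fingroup.
From mathcomp Require Import zify.

Set Implicit Arguments.
Unset Strict Implicit.
Unset Printing Implicit Defensive.

Lemma card_ord_itv n a b : b <= n -> #|[set c : 'I_n | a <= c < b]| = b - a.
Proof.
move=> le_bn; rewrite -sum1_card.
rewrite (eq_bigl (fun c : 'I_n => (a <= c < b))); last by move=> c; rewrite inE.
rewrite -(big_mkord (fun c => a <= c < b) (fun=> 1)) sum1_count -size_filter.
have -> : [seq c <- index_iota 0 n | a <= c < b] = index_iota a b.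
  apply: (irr_sorted_eq ltn_trans ltnn).
  - by apply: sorted_filter; [exact: ltn_trans | exact: iota_ltn_sorted].
  - exact: iota_ltn_sorted.
  by move=> c; rewrite mem_filter !mem_index_iota; lia.
by rewrite size_iota.
Qed.

(** * Lehmer codes of permutations *)

Section LehmerCode.

Variable n : nat.
Implicit Types (pi sigma : 'S_n) (i j c d q t : 'I_n).

Definition lehmer pi i := #|[set c : 'I_n | (c < i) && (pi c < pi i)]|.

Lemma card_perm_lt pi i : #|[set c : 'I_n | pi c < pi i]| = pi i.
Proof.
rewrite -[RHS]subn0 -(@card_ord_itv n 0 (pi i)) ?(ltnW (ltn_ord _)) //.
rewrite -(card_imset _ (@perm_inj _ pi)); apply: eq_card => c; rewrite inE /=.
apply/imsetP/idP => [[d]|lt_c]; first by rewrite inE => ? ->.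
by exists (pi^-1%g c); rewrite ?inE permKV.
Qed.

Lemma lehmer_le pi i : lehmer pi i <= i.
Proof.
rewrite -[X in _ <= X]subn0 -(@card_ord_itv n 0 i) ?(ltnW (ltn_ord _)) //.
by apply/subset_leq_card/subsetP => c; rewrite !inE => /andP[].
Qed.

Lemma perm_val_eq pi c d : (val (pi c) == val (pi d)) = (c == d).
Proof. by rewrite (inj_eq val_inj) (inj_eq perm_inj). Qed.

(** Decoding from right to left: once the values after [i] are known, the code at [i] is the rank of
    [pi i] among the values left over. *)
Lemma lehmer_inj pi sigma : lehmer pi =1 lehmer sigma -> pi = sigma.
Proof.
move=> eqL; apply/permP => i; move: {2}(n - i) (leqnn (n - i)) => m.
elim: m i => [|m IH] i; first by have := ltn_ord i; lia.
move=> le_m; have eq_later c : i < c -> pi c = sigma c.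
  by move=> lt_ic; apply: IH; have := ltn_ord c; lia.
(* [V v] holds the leftover values below [v]. It is built from [pi] alone but serves any [rho] that
   agrees with [pi] after [i]. Since [rho i] enters [V v] as soon as [v] exceeds it, the cardinality
   pins down [rho i]. *)
pose V (v : nat) := [set u : 'I_n | (u < v) && (pi^-1%g u <= i)].
have VP (rho : 'S_n) : (forall c, i < c -> rho c = pi c) ->
    lehmer rho i = #|V (rho i)| /\ (forall v : nat, rho i < v -> #|V (rho i)| < #|V v|).
  move=> eq_rho; have rhoV u : (rho^-1%g u <= i) = (pi^-1%g u <= i).
    rewrite leqNgt [RHS]leqNgt; congr negb; apply/idP/idP => lt_i; have := eq_rho _ lt_i.
      by rewrite (permKV rho) => eq_u; rewrite {1}eq_u (permK pi).
    by rewrite (permKV pi) => /esym eq_u; rewrite {1}eq_u (permK rho).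
  split=> [|v lt_v].
    rewrite /lehmer -(card_imset _ (@perm_inj _ rho)); apply: eq_card => u.
    rewrite [RHS]inE -rhoV; apply/imsetP/andP => [[c]|[lt_u le_i]].
      by rewrite inE => /andP[lt_c lt_rc] ->; split; rewrite ?(permK rho) // ltnW.
    exists (rho^-1%g u); rewrite ?(permKV rho) // inE (permKV rho) lt_u andbT.
    rewrite ltn_neqAle le_i andbT; apply: contraTneq lt_u => /val_inj <-.
    by rewrite (permKV rho) ltnn.
  apply/proper_card/properP; split.
    by apply/subsetP => u; rewrite !inE => /andP[lt_u ->]; rewrite (ltn_trans lt_u).
  by exists (rho i); rewrite inE -rhoV (permK rho) ?ltnn ?lt_v /=.
have [eq_p lt_p] := VP pi (fun _ _ => erefl).
have [|eq_s lt_s] := VP sigma; first by move=> c /eq_later.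
have eqV : #|V (pi i)| = #|V (sigma i)| by rewrite -eq_p -eq_s eqL.
apply: val_inj; case: (ltngtP (pi i) (sigma i)) => // [/lt_p|/lt_s]; rewrite eqV ltnn //.
Qed.

(** By counting: [code] is injective into the family of functions bounded by the identity, and that
    family has exactly [n]! members. *)
Lemma lehmer_surj (f : 'I_n -> nat) :
  (forall i, f i <= i) -> exists pi, lehmer pi =1 f.
Proof.
move=> le_f; have lt_lehmer pi i : lehmer pi i < n.
  exact: leq_ltn_trans (lehmer_le pi i) (ltn_ord i).
pose F i := [pred v : 'I_n | v <= i].
pose code pi := [ffun i => Ordinal (lt_lehmer pi i)].
have code_inj : injective code.
  move=> pi sigma eq_code; apply: lehmer_inj => i.
  by have := congr1 (fun g : {ffun 'I_n -> 'I_n} => val (g i)) eq_code; rewrite !ffunE.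
have card_F : #|family F| = n`!.
  rewrite card_family foldrE big_map big_enum /= fact_prod big_add1 big_mkord.
  apply: eq_bigr => i _; rewrite -[i.+1 in RHS]subn0 -(@card_ord_itv n 0 i.+1) //.
  by apply: eq_card => v; rewrite !inE.
have sub : code @: [set: 'S_n] \subset [set g in family F].
  apply/subsetP => _ /imsetP[pi _ ->]; rewrite inE; apply/familyP => i.
  by rewrite ffunE inE /= lehmer_le.
have eq_im : code @: [set: 'S_n] = [set g in family F].
  apply/eqP; rewrite eqEcard sub card_imset // cardsT card_Sn cardsE card_F leqnn //.
have lt_f i : f i < n := leq_ltn_trans (le_f i) (ltn_ord i).
have : [ffun i => Ordinal (lt_f i)] \in code @: [set: 'S_n].
  by rewrite eq_im inE; apply/familyP => i; rewrite ffunE inE /= le_f.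
case/imsetP => pi _ eq_f; exists pi => i.
by have := congr1 (fun g : {ffun 'I_n -> 'I_n} => val (g i)) eq_f; rewrite !ffunE.
Qed.

(** * Suffix minima read off the code *)

Definition last_argmin (L : 'I_n -> nat) i q :=
  [/\ i <= q, forall c, i <= c -> L q <= L c & forall c, q < c -> L q < L c].

Lemma last_argmin_uniq L i q q' : last_argmin L i q -> last_argmin L i q' -> q = q'.
Proof.
move=> [iq minq lastq] [iq' minq' lastq']; apply: val_inj => /=.
case: (ltngtP q q') => // [/lastq|/lastq'].
  by have := minq' q iq; lia.
by have := minq q' iq'; lia.
Qed.

Definition suffix_argmin pi i : 'I_n := [arg min_(c < i | i <= c) pi c].

Lemma suffix_argminP pi i :
  i <= suffix_argmin pi i /\ forall c, i <= c -> pi (suffix_argmin pi i) <= pi c.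
Proof. by rewrite /suffix_argmin; case: arg_minnP. Qed.

Lemma lehmer_suffix_min pi i q :
  i <= q -> (forall c, i <= c -> pi q <= pi c) -> lehmer pi q = pi q.
Proof.
move=> iq minq; rewrite -[RHS]card_perm_lt; apply: eq_card => c; rewrite !inE.
by case: ltnP => //= le_qc; have := minq c (leq_trans iq le_qc); lia.
Qed.

(** All values below [pi q] sit before [i], so they are counted in the code at every [c] from [i]
    on. For [c] after [q], the position [q] is counted as well, which makes the inequality
    strict. *)
Lemma suffix_min_last_argmin pi i q :
  i <= q -> (forall c, i <= c -> pi q <= pi c) -> last_argmin (lehmer pi) i q.
Proof.
move=> iq minq; have Lq := lehmer_suffix_min iq minq.
have before c d : i <= c -> pi d < pi q -> d < c.
  by move=> ic lt_d; case: ltnP => // le_cd; have := minq d (leq_trans ic le_cd); lia.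
split=> // c; rewrite Lq -(card_perm_lt pi q).
  move=> ic; apply/subset_leq_card/subsetP => d; rewrite !inE => lt_d.
  by rewrite (before c d) //=; have := minq c ic; lia.
move=> qc; have ic : i <= c by lia.
apply/proper_card/properP; split.
  apply/subsetP => d; rewrite !inE => lt_d.
  by rewrite (before c d) //=; have := minq c ic; lia.
exists q; rewrite inE ?ltnn // qc /= ltn_neqAle minq // andbT perm_val_eq.
by rewrite neq_ltn qc.
Qed.

Lemma last_argmin_suffix_argmin pi i :
  last_argmin (lehmer pi) i (suffix_argmin pi i).
Proof. by have [le_i min_i] := suffix_argminP pi i; apply: suffix_min_last_argmin. Qed.

Lemma last_argminP pi i q :
  last_argmin (lehmer pi) i q -> q = suffix_argmin pi i.
Proof. by move=> /last_argmin_uniq; apply; apply: last_argmin_suffix_argmin. Qed.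

(** * The reflection of codes and the involution *)

Definition flip pi i :=
  let q := suffix_argmin pi i in
  if q == i then lehmer pi i else i + lehmer pi q - lehmer pi i.

Lemma flip_le pi i : flip pi i <= i.
Proof.
rewrite /flip; have [_ min_i _] := last_argmin_suffix_argmin pi i.
by have := min_i i (leqnn i); have := lehmer_le pi i; case: ifP; lia.
Qed.

Lemma flip_ge pi i : lehmer pi (suffix_argmin pi i) <= flip pi i.
Proof.
rewrite /flip; have [_ min_i _] := last_argmin_suffix_argmin pi i.
by have := min_i i (leqnn i); have := lehmer_le pi i; case: ifP => [/eqP ->|_]; lia.
Qed.

Lemma suffix_argmin_idem pi i :
  suffix_argmin pi (suffix_argmin pi i) = suffix_argmin pi i.
Proof.
have [le_i min_i last_i] := last_argmin_suffix_argmin pi i.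
symmetry; apply: last_argminP; split=> // c le_c; apply: min_i.
exact: leq_trans le_i le_c.
Qed.

Lemma flip_suffix_argmin pi i :
  flip pi (suffix_argmin pi i) = lehmer pi (suffix_argmin pi i).
Proof. by rewrite /flip suffix_argmin_idem eqxx. Qed.

(** The code at the suffix minimum is unchanged. At any other [c] the reflected code is still at
    least the code at the suffix minimum of [c], a position not before [c], so both inequalities
    carry over from [lehmer pi]. *)
Lemma last_argmin_flip pi i : last_argmin (flip pi) i (suffix_argmin pi i).
Proof.
have [le_i min_i last_i] := last_argmin_suffix_argmin pi i.
split=> // c lt_c; rewrite flip_suffix_argmin; have [le_c _ _] := last_argmin_suffix_argmin pi c.
  by apply: leq_trans (flip_ge pi c); apply: min_i; lia.
by apply: leq_trans (flip_ge pi c); apply: last_i; lia.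
Qed.

(** The default [1] is never reached: [flip pi] is a valid code by [flip_le], hence realised by a
    permutation. *)
Definition Phi pi : 'S_n := odflt 1%g [pick sigma | [forall i, lehmer sigma i == flip pi i]].

Lemma lehmer_Phi pi : lehmer (Phi pi) =1 flip pi.
Proof.
move=> i; rewrite /Phi; case: pickP => [sigma /forallP/(_ i)/eqP //|none].
have [sigma eq_f] := lehmer_surj (flip_le pi).
by have /forallP[] := negbT (none sigma) => c; rewrite eq_f.
Qed.

Lemma suffix_argmin_Phi pi i : suffix_argmin (Phi pi) i = suffix_argmin pi i.
Proof.
symmetry; apply: last_argminP; have [le_i min_i last_i] := last_argmin_flip pi i.
by split=> // c; rewrite !lehmer_Phi; [apply: min_i | apply: last_i].
Qed.

(** Suffix minima and the codes there are preserved, so the second reflection is in the same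
    interval as the first. *)
Lemma PhiK : involutive Phi.
Proof.
move=> pi; apply: lehmer_inj => i; rewrite lehmer_Phi {1}/flip suffix_argmin_Phi.
rewrite !lehmer_Phi flip_suffix_argmin /flip.
have [_ min_i _] := last_argmin_suffix_argmin pi i.
by have := min_i i (leqnn i); have := lehmer_le pi i; case: (_ == i); lia.
Qed.

End LehmerCode.

(** * Occurrences of mesh patterns on 21 *)

Section Occurrence21.

Variable n : nat.
Implicit Types (pi : 'S_n) (i j c d t : 'I_n) (b : nat * nat).

(* b is the pair (column, row). *)
Definition box21 pi i j b c :=
  nth false [:: c < i; i < c < j; j < c] b.1 &&
  nth false [:: pi c < pi j; pi j < pi c < pi i; pi i < pi c] b.2.

Definition empty_box21 pi i j b := [forall c, ~~ box21 pi i j b c].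

Lemma forall_ord2 (P : pred 'I_2) : [forall x, P x] = P ord0 && P ord_max.
Proof.
apply/forallP/andP => [P_all | [P0 P1] [[|[|//]] lt_x]]; first by split.
  by rewrite (_ : Ordinal _ = ord0) //; apply: val_inj.
by rewrite (_ : Ordinal _ = ord_max) //; apply: val_inj.
Qed.

Lemma enum_ord2 : enum 'I_2 = [:: ord0; ord_max].
Proof. by apply: (inj_map val_inj); rewrite val_enum_ord. Qed.

Lemma in_box21 pi (a : {ffun 'I_2 -> 'I_n}) (b : 'I_3 * 'I_3) c :
  a ord0 < a ord_max -> pi (a ord_max) < pi (a ord0) ->
  in_box pi a b c = box21 pi (a ord0) (a ord_max) (val b.1, val b.2) c.
Proof.
move=> lt_a lt_pa; rewrite /in_box /column_bound /row_bound enum_ord2 /=.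
have -> : sort leq [:: (pi (a ord0)).+1; (pi (a ord_max)).+1]
    = [:: (pi (a ord_max)).+1; (pi (a ord0)).+1].
  apply: (sorted_eq leq_trans anti_leq); first exact: sort_sorted leq_total _.
    by rewrite /= ltnS ltnW.
  by rewrite perm_sort; apply: (permEl (perm_catC [:: _] [:: _])).
have := ltn_ord c; have := ltn_ord (pi c).
by case: b => -[[|[|[|//]]] ?] [[|[|[|//]]] ?]; rewrite /box21 /=; lia.
Qed.

Lemma occurrence_mesh21 boxes pi (a : {ffun 'I_2 -> 'I_n}) (i := a ord0) (j := a ord_max) :
  all (fun b => (b.1 < 3) && (b.2 < 3)) boxes ->
  occurrence (mesh21 boxes) pi a =
  [&& i < j, pi j < pi i & all (empty_box21 pi i j) boxes].
Proof.
move=> /allP boxes_lt; rewrite /occurrence.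
have -> : increasing_positions a = (i < j).
  by rewrite /increasing_positions !forall_ord2 /= andbT.
have -> : order_isomorphic (mesh21 boxes) pi a = (pi j < pi i).
  rewrite /order_isomorphic !forall_ord2 /= tpermL tpermR !ltnn !eqxx /=.
  by rewrite andbT /i /j; case: ltngtP.
apply: andb_id2l => lt_ij; apply: andb_id2l => lt_pij.
apply/forallP/allP => [empty [k l] in_kl | empty b].
  have /andP[/= lt_k lt_l] := boxes_lt _ in_kl.
  apply/forallP => c; have /implyP := empty (Ordinal lt_k, Ordinal lt_l).
  by rewrite inE => /(_ in_kl)/existsPn/(_ c); rewrite in_box21.
apply/implyP; rewrite inE => /empty/forallP empty_b; apply/existsPn => c.
by rewrite in_box21.
Qed.

(** * Empty boxes in terms of the code, when [j] is the suffix minimum from [i] *)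

Variables (pi : 'S_n) (i j : 'I_n).
Hypotheses (lt_ij : i < j) (min_j : forall c, i <= c -> pi j <= pi c).

Lemma suffix_min_lt : pi j < pi i.
Proof.
by rewrite ltn_neqAle min_j // andbT perm_val_eq neq_ltn lt_ij orbT.
Qed.

Lemma before_suffix_min c : pi c < pi j -> c < i.
Proof. by move=> lt_c; case: (ltnP c i) => // /min_j; lia. Qed.

Lemma lehmer_min : lehmer pi j = pi j.
Proof. exact: lehmer_suffix_min (ltnW lt_ij) min_j. Qed.

(** The positions of values below [pi j] are among those counted by the code at [i], and the
    difference of the two sets is the content of the box. *)
Lemma empty_box01P : empty_box21 pi i j (0, 1) = (lehmer pi i == lehmer pi j).
Proof.
rewrite lehmer_min -(card_perm_lt pi j) eq_sym.
have sub : [set c : 'I_n | pi c < pi j] \subset [set c : 'I_n | (c < i) && (pi c < pi i)].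
  apply/subsetP => c; rewrite !inE => lt_c; rewrite (before_suffix_min lt_c).
  exact: ltn_trans suffix_min_lt.
rewrite /lehmer (subset_leqif_cards sub) eqEsubset sub /=.
apply/forallP/subsetP => [empty c | sub' c].
  rewrite !inE => /andP[lt_c lt_pc]; have := empty c.
  rewrite /box21 /= lt_c lt_pc andbT /= -leqNgt leq_eqVlt perm_val_eq.
  by case: eqP => // eq_cj; move: lt_c; rewrite eq_cj; lia.
rewrite /box21 /=; apply/negP => /andP[lt_c /andP[lt_jc lt_ci]].
by have := sub' c; rewrite !inE lt_c lt_ci => /(_ isT); lia.
Qed.

Lemma empty_box02P : empty_box21 pi i j (0, 2) = (lehmer pi i == i).
Proof.
rewrite -[X in _ == X]subn0 -(@card_ord_itv n 0 i) ?(ltnW (ltn_ord _)) //.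
have sub : [set c : 'I_n | (c < i) && (pi c < pi i)] \subset [set c : 'I_n | 0 <= c < i].
  by apply/subsetP => c; rewrite !inE => /andP[].
rewrite (subset_leqif_cards sub) eqEsubset sub /=.
apply/forallP/subsetP => [empty c | sub' c].
  rewrite !inE /= => lt_c; have := empty c.
  rewrite /box21 /= lt_c /= -leqNgt leq_eqVlt perm_val_eq.
  by case: eqP => // eq_cj; move: lt_c; rewrite eq_cj; lia.
rewrite /box21 /=; apply/negP => /andP[lt_c lt_ic].
by have := sub' c; rewrite !inE lt_c => /(_ isT); lia.
Qed.

(** If the box is empty, a position counted at [t] has value below [pi j] or lies strictly between
    [i] and [t]. Conversely, the leftmost [t] in the box would have too large a code. *)
Lemma empty_box12P : empty_box21 pi i j (0, 1) ->
  empty_box21 pi i j (1, 2) =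
  [forall t : 'I_n, (i < t < j) ==> (lehmer pi t + i < lehmer pi j + t)].
Proof.
move=> /forallP empty01; rewrite lehmer_min.
have lt_tn t : t <= n by apply: ltnW.
apply/forallP/forallP => [empty t | lt_L].
  apply/implyP => /andP[lt_it lt_tj].
  have lt_ti : pi t < pi i.
    have := empty t; rewrite /box21 /= lt_it lt_tj /= -leqNgt leq_eqVlt perm_val_eq.
    by case: eqP => // eq_ti; move: lt_it; rewrite eq_ti; lia.
  have : lehmer pi t <= #|[set c : 'I_n | pi c < pi j] :|: [set c : 'I_n | i.+1 <= c < t]|.
    apply/subset_leq_card/subsetP => c; rewrite !inE => /andP[lt_ct lt_pct].
    have := empty01 c; rewrite /box21 /=.
    have := perm_val_eq pi c j; have := perm_val_eq pi c i.
    rewrite -!(inj_eq val_inj) /=; lia.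
  move/leq_trans/(_ (leq_card_setU _ _)).
  by rewrite card_perm_lt card_ord_itv //; lia.
have between t : i < t -> t < j -> pi t < pi i.
  have [m le_m] := ubnP (t : nat); elim: m t le_m => // m IH t le_m lt_it lt_tj.
  rewrite ltnNge; apply/negP => le_it.
  (* By induction no position between [i] and [t] is in the box, so all of [i], ..., [t - 1] have
     values below [pi t]. The [pi j] positions of values below [pi j] are counted too, and they all
     precede [i]. *)
  suff : pi j + (t - i) <= lehmer pi t by have := lt_L t; rewrite lt_it lt_tj /=; lia.
  rewrite -(card_perm_lt pi j) -(@card_ord_itv n i t) //.
  have /eqP <- : #|[set c : 'I_n | pi c < pi j] :|: [set c : 'I_n | i <= c < t]| ==
       #|[set c : 'I_n | pi c < pi j]| + #|[set c : 'I_n | i <= c < t]|.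
    rewrite leq_card_setU -setI_eq0; apply/eqP/setP => c; rewrite !inE.
    by have := @before_suffix_min c; lia.
  apply/subset_leq_card/subsetP => c; rewrite !inE.
  have := @before_suffix_min c; have := suffix_min_lt.
  have := IH c; have := perm_val_eq pi t i; have := perm_val_eq pi c i.
  rewrite -!(inj_eq val_inj) /=; lia.
move=> t; rewrite /box21 /=; apply/negP => /andP[/andP[lt_it lt_tj]].
by have := between t lt_it lt_tj; lia.
Qed.

(** All positions before [i] now have values below [pi i]. If the box is empty, the code at [t]
    counts all of 0, ..., [i]. Conversely, at the leftmost [t] in the box, only positions before [i]
    can be counted. *)
Lemma empty_box11P : empty_box21 pi i j (0, 2) ->
  empty_box21 pi i j (1, 1) = [forall t : 'I_n, (i < t < j) ==> (i < lehmer pi t)].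
Proof.
move=> /forallP empty02.
have lt_tn t : t < n := ltn_ord t.
apply/forallP/forallP => [empty t | lt_L].
  apply/implyP => /andP[lt_it lt_tj].
  have lt_ti : pi i < pi t.
    have := empty t; rewrite /box21 /= lt_it lt_tj /=.
    have := min_j (ltnW lt_it); have := perm_val_eq pi t j; have := perm_val_eq pi t i.
    rewrite -!(inj_eq val_inj) /=; lia.
  rewrite -[X in X < _]subn0 -subSn // -(@card_ord_itv n 0 i.+1) //.
  apply/subset_leq_card/subsetP => c; rewrite !inE /= => le_ci.
  have := empty02 c; rewrite /box21 /=.
  have := perm_val_eq pi c i; rewrite -!(inj_eq val_inj) /=; lia.
have between t : i < t -> t < j -> pi i < pi t.
  have [m le_m] := ubnP (t : nat); elim: m t le_m => // m IH t le_m lt_it lt_tj.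
  rewrite ltnNge; apply/negP => le_it.
  suff : lehmer pi t <= i by have := lt_L t; rewrite lt_it lt_tj /=; lia.
  rewrite -[X in _ <= X]subn0 -(@card_ord_itv n 0 i) ?(ltnW (lt_tn _)) //.
  apply/subset_leq_card/subsetP => c; rewrite !inE /=.
  have := IH c; have := perm_val_eq pi t i; have := perm_val_eq pi c i.
  rewrite -!(inj_eq val_inj) /=; lia.
move=> t; rewrite /box21 /=; apply/negP => /andP[/andP[lt_it lt_tj]].
by have := between t lt_it lt_tj; lia.
Qed.

End Occurrence21.

(** * Effect of the reflection on occurrences *)

Section FlipOccurrences.

Variable n : nat.
Implicit Types (pi : 'S_n) (i j c t : 'I_n).

(** Together the three conditions leave no position from [i] on with a value below [pi j]. *)
Lemma empty_row0P pi i j : i < j ->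
  [&& pi j < pi i, empty_box21 pi i j (1, 0) & empty_box21 pi i j (2, 0)]
  = (j == suffix_argmin pi i).
Proof.
move=> lt_ij; apply/and3P/eqP => [[lt_p /forallP empty1 /forallP empty2] | eq_j].
  apply: last_argminP; apply: suffix_min_last_argmin => [|c le_ic]; first exact: ltnW.
  have := empty1 c; have := empty2 c; rewrite /box21 /=.
  have [/val_inj ->|/eqP ne_ci] := eqVneq (c : nat) i; first by lia.
  by have [/val_inj ->|/eqP ne_cj] := eqVneq (c : nat) j; lia.
have [_ min_j] := suffix_argminP pi i; rewrite -eq_j in min_j.
split; first exact: suffix_min_lt lt_ij min_j.
  by apply/forallP => c; rewrite /box21 /=; have := min_j c; lia.
by apply/forallP => c; rewrite /box21 /=; have := min_j c; lia.
Qed.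

Lemma empty_box21_Phi pi i j : i < j -> j = suffix_argmin pi i ->
  [/\ empty_box21 (Phi pi) i j (0, 2) = empty_box21 pi i j (0, 1),
      empty_box21 (Phi pi) i j (0, 1) = empty_box21 pi i j (0, 2)
    & empty_box21 pi i j (0, 1) ->
      empty_box21 (Phi pi) i j (1, 1) = empty_box21 pi i j (1, 2)].
Proof.
move=> lt_ij eq_j.
have [_ min_j] := suffix_argminP pi i; rewrite -eq_j in min_j.
have [_] := suffix_argminP (Phi pi) i; rewrite suffix_argmin_Phi -eq_j => min_j'.
have [_ minL lastL] := last_argmin_suffix_argmin pi i; rewrite -eq_j in minL lastL.
have Lj : lehmer (Phi pi) j = lehmer pi j by rewrite lehmer_Phi eq_j flip_suffix_argmin.
(* Every [t] from [i] up to [j] has the same suffix minimum [j], so all these codes are reflected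
   with the same [lehmer pi j]. *)
have Lt t : i <= t -> t < j -> lehmer (Phi pi) t = t + lehmer pi j - lehmer pi t.
  move=> le_it lt_tj; rewrite lehmer_Phi /flip.
  have <- : j = suffix_argmin pi t.
    apply: last_argminP; split=> // [|c le_tc]; first exact: ltnW.
    by apply: minL; apply: leq_trans le_it le_tc.
  by case: eqP => // eq_jt; move: lt_tj; rewrite eq_jt ltnn.
have := Lt i (leqnn i) lt_ij; have := minL i (leqnn i); have := lehmer_le pi i.
move=> le_i ge_i Li.
have eq02 : empty_box21 (Phi pi) i j (0, 2) = empty_box21 pi i j (0, 1).
  by rewrite empty_box02P // empty_box01P // Li; lia.
split=> //; first by rewrite empty_box02P // empty_box01P // Li Lj; lia.
move=> empty01; rewrite empty_box11P // ?eq02 // empty_box12P //.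
apply: eq_forallb => t; have := Lt t; have := minL t; have := lehmer_le pi t.
by case: (ltnP i t) => //= lt_it; case: (ltnP t j) => //= lt_tj; lia.
Qed.

End FlipOccurrences.

Theorem theorem1p6 (n : nat) (n_ge1 : 1 <= n) :
  exists Phi : 'S_n -> 'S_n,
    involutive Phi /\
    forall pi : 'S_n,
      [/\ mesh_count (mesh21 [:: (0, 1); (1, 0); (2, 0)]) pi
          = mesh_count (mesh21 [:: (0, 2); (1, 0); (2, 0)]) (Phi pi),
          mesh_count (mesh21 [:: (0, 1); (0, 2); (1, 0); (1, 2); (2, 0)]) pi
          = mesh_count (mesh21 [:: (0, 1); (0, 2); (1, 0); (1, 1); (2, 0)]) (Phi pi)
        & mesh_count (mesh21 [:: (0, 1); (1, 0); (1, 2); (2, 0)]) pi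
          = mesh_count (mesh21 [:: (0, 2); (1, 0); (1, 1); (2, 0)]) (Phi pi)].
Proof.
exists (@Phi n); split=> [|pi]; first exact: PhiK.
(* The same [a] is compared on both sides. Unless [a ord_max] is the suffix minimum from [a ord0],
   which [pi] and [Phi pi] share, the row 0 conditions fail for both. *)
split; apply: eq_card => a; rewrite !inE !occurrence_mesh21 //=;
  (case: (ltnP (a ord0) (a ord_max)) => //= lt_a);
  have := empty_row0P pi lt_a; have := empty_row0P (Phi pi) lt_a;
  rewrite suffix_argmin_Phi;
  (case: eqP => [/(empty_box21_Phi lt_a)[-> eq01 eq11] /and3P[-> -> ->] /and3P[-> -> ->] | _]);
  rewrite ?andbT ?eq01 //=.
- by case: (_ < _); case: (_ < _); do ![case: (empty_box21 _ _ _ _) => //=].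
(* [eq11] is available only when box (0, 1) is empty for [pi]; otherwise both sides are false. *)
- by case: empty_box21 eq11 => [->|]; rewrite ?andbF.
- by case: (_ < _); case: (_ < _); do ![case: (empty_box21 _ _ _ _) => //=].
- by case: empty_box21 eq11 => [->|].
- by case: (_ < _); case: (_ < _); do ![case: (empty_box21 _ _ _ _) => //=].
Qed.
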